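(* There is a set $Y\subset\mathbb{R}^2$ which is a union of three translated lattices, which is uniformly discrete, and which is a dense forest with the following visibility bound: for every $\eta>0$ there is a constant $C>0$ such that for every $0<\varepsilon<1$, every line segment of length $C\varepsilon^{-(5+\eta)}$ comes within distance $\varepsilon$ of $Y$ (i.e. $v(\varepsilon)=O(\varepsilon^{-(5+\eta)})$ for any $\eta>0$).
   Context: A translated lattice in $\mathbb{R}^2$ is a set $\bm{x}+\Lambda$ with $\Lambda$ a lattice of rank 2. A set is uniformly discrete if there is a uniform positive lower bound on the distance between two distinct points of it. A set $Y$ is a dense forest if there is a function $v$ (a visibility function) such that for each $\varepsilon>0$ every line segment of length $v(\varepsilon)$ comes within distance $\varepsilon$ of $Y$. *)

(* Defs.v *)
From HB Require Import structures.
From mathcomp Require Import all_boot all_order all_algebra.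
From mathcomp Require Import all_classical all_reals all_analysis.

Set Implicit Arguments.
Unset Strict Implicit.
Unset Printing Implicit Defensive.

Import Order.TTheory GRing.Theory Num.Theory.
Import numFieldNormedType.Exports.

Local Open Scope classical_set_scope.
Local Open Scope ring_scope.

Section DenseForests.
Context {R : realType}.
Implicit Types (x y a b : 'rV[R]_2) (L S Y : set 'rV[R]_2).

(* Euclidean distance; the library norm on 'rV[R]_2 is the sup norm. *)
Definition euclid_dist x y : R := Num.sqrt (\sum_(i < 2) (x 0 i - y 0 i) ^+ 2).

(* The rows of the invertible matrix B are a Z-basis of the lattice. *)
Definition is_lattice L : Prop :=
  exists2 B : 'M[R]_2, B \in unitmx &
    L = [set map_mx intr z *m B | z in [set: 'rV[int]_2]].

Definition is_translated_lattice S : Prop :=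
  exists x L, is_lattice L /\ S = [set x + l | l in L].

Definition uniformly_discrete Y : Prop :=
  exists2 r : R, 0 < r & forall x y, Y x -> Y y -> x <> y -> r <= euclid_dist x y.

Definition line_segment a b : set 'rV[R]_2 :=
  [set (1 - t) *: a + t *: b | t in `[0 : R, 1]].

Definition comes_within (e : R) S Y : Prop :=
  exists x y, [/\ S x, Y y & euclid_dist x y <= e].

Definition visible_length Y (e l : R) : Prop :=
  forall a b, euclid_dist a b = l -> comes_within e (line_segment a b) Y.

(* Without 0 < v e the length condition would be vacuous for v e < 0. *)
Definition is_visibility_function Y (v : R -> R) : Prop :=
  forall e : R, 0 < e -> 0 < v e /\ visible_length Y e (v e).

Definition dense_forest Y : Prop := exists v, is_visibility_function Y v.

End DenseForests.

(* Main.v *)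
(** Let t = 2^(1/3) and consider the linear forms u = x, v = y, w = t x + t^2 y.
    Each grid prescribes modulo 1 the values of two of the three forms (u,v),
    (v,w), (w,u).  Any two grids share a form, whose prescribed values differ by
    1/2, so the union is uniformly discrete.

    A segment with direction vector d of length l winds around the torus R^2/Z^2
    via two of the forms, and it gets within 2/Q of every point unless
    |k(d)| < 2 for some nonzero integer combination k of the two forms with
    coefficients at most Q.  If all three grids are resonant in this sense, with
    combinations k1, k2, k3, then det(k1, k2) and det(k2, k3) are O(Q/l).  These
    determinants have the form a + b t + c t^2 with integers a, b, c = O(Q^2),
    so each is 0 or at least of order Q^-4, as the norm of a nonzero element of
    Z[t] is a nonzero integer.  For l of order Q^5 both vanish, hence so do all
    their coefficients a, b, c, which is impossible for nonzero k1, k2, k3.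
    With Q of order 1/eps this even gives visibility O(eps^-5). *)

Require Import Defs.
From HB Require Import structures.
From mathcomp Require Import all_boot all_order all_algebra.
From mathcomp Require Import all_classical all_reals all_analysis.
From mathcomp Require Import zify ring lra.

Import Order.TTheory GRing.Theory Num.Theory.
Import numFieldNormedType.Exports.

Local Open Scope classical_set_scope.
Local Open Scope ring_scope.

(** * Diophantine approximation and linear flow on the torus *)

Lemma intr_norm_ge1 (R : realType) (n : int) : n != 0 -> 1 <= `|n%:~R : R|.
Proof.
by move=> n0; rewrite -intr_norm -[1]/(1%:~R) ler_int -gtz0_ge1 normr_gt0.
Qed.

(** Pigeonhole on the fractional parts of [j * s]; dividing out the gcd only shrinks the error. The
    Bezout coefficients serve to invert [p] modulo [q]. *)
Lemma dirichlet_coprime (R : realType) (s : R) (Q : nat) : (0 < Q)%N ->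
  exists p q u v : int,
    [/\ 0 < q <= Q%:Z, u * p + v * q = 1
      & `|q%:~R * s - p%:~R| * Q%:R < 1].
Proof.
case: Q => // Q _.
pose w (j : nat) : R := j%:R * s - (Num.floor (j%:R * s))%:~R.
have w01 j : 0 <= w j < 1.
  by rewrite /w; have := floor_itv (j%:R * s); rewrite intrD; lra.
pose G j := Num.floor (Q.+1%:R * w j).
have G01 j : 0 <= G j < Q.+1%:Z.
  have /andP[h1 h2] := w01 j.
  rewrite /G floor_ge0 floor_lt_int mulr_ge0 //=.
  by rewrite -[X in _ < X]mulr1 ltr_pM2l // ltr0n.
pose F (j : 'I_Q.+2) : 'I_Q.+1 := inord `|G j|%N.
have [i [j [ij Fij]]] : exists i j : 'I_Q.+2, (i < j)%N /\ F i = F j.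
  have /injectivePn[i [j ij Fij]] : ~~ injectiveb F.
    by apply/negP => /injectiveP/leq_card; rewrite !card_ord ltnn.
  case: (ltngtP i j) => h; first by exists i, j.
    by exists j, i.
  by move: ij; rewrite -val_eqE /= h eqxx.
have GE : G i = G j.
  move/(congr1 val): Fij; rewrite /F /= !inordK.
  - by have := G01 i; have := G01 j; lia.
  - by have := G01 j; lia.
  - by have := G01 i; lia.
pose q0 : int := j%:Z - i%:Z.
pose p0 := Num.floor (j%:R * s) - Num.floor (i%:R * s).
have q0E : (q0%:~R * s - p0%:~R : R) = w j - w i.
  by rewrite /q0 /p0 /w !intrB -!pmulrn; ring.
have close0 : `|q0%:~R * s - p0%:~R| * Q.+1%:R < 1.
  rewrite q0E -[X in _ * X]ger0_norm // -normrM ltr_norml.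
  have := floor_itv (Q.+1%:R * w i); have := floor_itv (Q.+1%:R * w j).
  by rewrite -/(G i) -/(G j) GE !intrD mulrBl ![w _ * _]mulrC; lra.
have q0_gt0 : 0 < q0 by rewrite /q0; lia.
have q0_le : q0 <= Q.+1%:Z by rewrite /q0; have := ltn_ord j; lia.
have [u [v uv]] := Bezoutz p0 q0.
have [p pE] : exists p, p0 = p * gcdz p0 q0 by apply/dvdzP; exact: dvdz_gcdl.
have [q qE] : exists q, q0 = q * gcdz p0 q0 by apply/dvdzP; exact: dvdz_gcdr.
set g := gcdz p0 q0 in uv pE qE.
have g_gt0 : 0 < g.
  by rewrite lt_neqAle eq_sym gcdz_eq0 (gt_eqF q0_gt0) andbF.
have q_gt0 : 0 < q by move: q0_gt0; rewrite qE pmulr_lgt0.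
exists p, q, u, v; split.
- by rewrite q_gt0 (le_trans _ q0_le)// qE ler_peMr ?(ltW q_gt0)// -gtz0_ge1.
- apply/(mulIf (lt0r_neq0 g_gt0)).
  by rewrite mul1r -[RHS]uv pE qE; ring.
- apply: le_lt_trans close0; rewrite ler_wpM2r //.
  have -> : (q0%:~R * s - p0%:~R : R) = g%:~R * (q%:~R * s - p%:~R).
    by rewrite qE pE !intrM; ring.
  rewrite normrM ler_peMl //; apply: intr_norm_ge1; exact: lt0r_neq0.
Qed.

(** The next integer in the direction of [h] is less than 1 away, and stopping at the last step that
    does not pass it leaves an error of at most one step. *)
Lemma drift_near_int (R : realType) (z h : R) : h != 0 ->
  exists (i : nat) (c : int), `|z + i%:R * h - c%:~R| <= `|h| /\ i%:R * `|h| <= 1.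
Proof.
wlog h_gt0 : z h / 0 < h.
  move=> H h0; have [h_gt0|h_lt0|/eqP] := ltgtP 0 h; first exact: H.
    have [||i [c [ic1 ic2]]] := H (- z) (- h); rewrite ?oppr_gt0 ?oppr_eq0//.
    exists i, (- c); split; last by rewrite -normrN.
    by rewrite -normrN -[X in _ <= X]normrN; move: ic1; rewrite intrN;
       congr (`|_| <= _); ring.
  by rewrite eq_sym (negPf h0).
move=> _; rewrite gtr0_norm //.
have /andP[c1 c2] := ceil_itv z; rewrite intrB in c1.
set c := Num.ceil z in c1 c2.
have y_ge0 : 0 <= (c%:~R - z) / h by rewrite divr_ge0 ?subr_ge0 // ltW.
have := floor_itv ((c%:~R - z) / h).
have : 0 <= Num.floor ((c%:~R - z) / h) by rewrite floor_ge0.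
case: (Num.floor _) => // i _; rewrite intrD -pmulrn ler_pdivlMr // ltr_pdivrMr //.
move=> /andP[i1 i2]; exists i, c; split; last lra.
by rewrite ler_norml; lra.
Qed.

(** The threshold 2 lets the drift in [flow_near_int_aux] be completed within half of the length
    [A]; the other half absorbs rounding and the choice of residue. *)
Definition nonresonant (R : realType) (A B : R) (Q : nat) : Prop :=
  forall m n : int, (m, n) != (0, 0) -> `|m| <= Q%:Z -> `|n| <= Q%:Z ->
    2 <= `|m%:~R * A + n%:~R * B|.

(* Along the times where the first coordinate is an integer, the second one is
   rotated by s = B / A.  With |q s - p| = d < 1/Q, the rotation visits q nearly
   equally spaced points and drifts by d every q steps, so it needs to drift by
   1/q only: about 1/d steps suffice, instead of the naive q/d. *)
Lemma flow_near_int_aux (R : realType) (A B x y : R) (Q : nat) :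
  (0 < Q)%N -> 0 < A -> `|B| <= A -> 2 * Q%:R + 2 <= A ->
  nonresonant R A B Q ->
  exists (r : R) (i j : int),
    [/\ 0 <= r <= 1, `|x + r * A - i%:~R| <= 2 / Q%:R
      & `|y + r * B - j%:~R| <= 2 / Q%:R].
Proof.
move=> Q_gt0 A_gt0 BA QA nores.
have QR : 0 < Q%:R :> R by rewrite ltr0n.
have A0 : A != 0 by rewrite gt_eqF.
have [p [q [u [v [/andP[q_gt0 qQ] uv dQ]]]]] := dirichlet_coprime _ (B / A) _ Q_gt0.
set s := B / A in dQ; set e := q%:~R * s - p%:~R in dQ.
have s1 : `|s| <= 1 by rewrite /s normrM normfV (gtr0_norm A_gt0) ler_pdivrMr // mul1r.
have qR : 0 < q%:~R :> R by rewrite ltr0z.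
have qQR : q%:~R <= Q%:R :> R by rewrite pmulrn ler_int.
have e1 : `|e| < 1.
  apply: le_lt_trans dQ; rewrite ler_peMr // -[1]/(1%:R) ler_nat //.
(* [|p| < q + 1] by [|s| <= 1] and [|e| < 1], hence [|p| <= q] as both are integers. *)
have pQ : `|p| <= Q%:Z.
  apply: le_trans qQ; rewrite -ltzD1 -(ltr_int R) intr_norm intrD.
  have -> : p%:~R = q%:~R * s - e :> R by rewrite /e; ring.
  apply: le_lt_trans (ler_normB _ _) _; rewrite ler_ltD //.
  by rewrite normrM (gtr0_norm qR) ler_piMr // ltW.
have eA : 2 <= `|e| * A.
  have := nores (- p) q; rewrite normrN (gtr0_norm q_gt0) => /(_ _ pQ qQ).
  rewrite xpair_eqE (gt_eqF q_gt0) andbF => /(_ isT).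
  suff -> : `|e| * A = `|(- p)%:~R * A + q%:~R * B| by [].
  rewrite -[in LHS](gtr0_norm A_gt0) -normrM intrN.
  by congr `|_|; rewrite /e /s; field.
have e_gt0 : 0 < `|e| by rewrite -(pmulr_lgt0 _ A_gt0); lra.
have e0 : e != 0 by rewrite -normr_gt0.
have /andP[x1 x2] := ceil_itv x; rewrite intrB in x1.
set n0 := Num.ceil x in x1 x2.
(* [y'] is the second coordinate when the first one reaches the integer [n0]. Every [q] further
   units shift it by [e] modulo 1, so its multiple by [q] drifts in steps of [q * e]. *)
pose y' := y + (n0%:~R - x) * s.
have [] := drift_near_int _ (q%:~R * y') (q%:~R * e).
  by rewrite mulf_neq0 // gt_eqF.
move=> i [c []]; rewrite normrM (gtr0_norm qR) => ic1 ic2.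
(* [u] inverts [p] modulo [q], so [j'] extra units cancel [c] modulo [q]. *)
pose j' := ((- (c * u)) %% q)%Z; pose t := ((- (c * u)) %/ q)%Z.
have j'E : j' = - (c * u) - t * q by rewrite [X in _ = X - _](divz_eq _ q) addrC addKr.
have j'_ge0 : 0 <= j' by apply: modz_ge0; rewrite gt_eqF.
have j'_lt : j' < q by rewrite ltz_pmod.
pose k := c * v - t * p.
have ck : c + j' * p = k * q.
  have cE : c = c * (u * p + v * q) by rewrite uv mulr1.
  by rewrite {1}cE j'E /k; ring.
clearbody j' k.
have j'_ge0R : 0 <= j'%:~R :> R by rewrite ler0z.
have j'_ltR : j'%:~R < q%:~R :> R by rewrite ltr_int.
have iqA : i%:R * q%:~R <= A / 2.
  rewrite -(ler_pM2r e_gt0) -mulrA (le_trans ic2) //; lra.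
pose n : R := i%:R * q%:~R + j'%:~R.
have n_ge0 : 0 <= n by rewrite addr_ge0 // mulr_ge0 // ltW.
(* The time at which the first coordinate is the integer [n0 + n]. *)
exists ((n0%:~R + n - x) / A), (n0 + (i%:Z * q + j')), (k + i%:Z * p); split.
- apply/andP; split; first by rewrite divr_ge0 ?(ltW A_gt0) //; lra.
  by rewrite ler_pdivrMr // /n; lra.
- rewrite divfK // !intrD intrM -pmulrn.
  rewrite [X in `|X|](_ : _ = 0) ?normr0 ?divr_ge0 // /n; ring.
- rewrite -(ler_pM2l qR) -[X in X * _ <= _](gtr0_norm qR) -normrM.
  have ckR : c%:~R + j'%:~R * p%:~R = k%:~R * q%:~R :> R.
    by rewrite -!intrM -intrD ck.
  have -> : q%:~R * (y + (n0%:~R + n - x) / A * B - (k + i%:Z * p)%:~R) =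
      (q%:~R * y' + i%:R * (q%:~R * e) - c%:~R) + j'%:~R * e.
    rewrite -[_ / A * B]mulrA [A^-1 * B]mulrC -/s !intrD intrM -pmulrn.
    apply/eqP; rewrite -subr_eq0; apply/eqP.
    transitivity (c%:~R + j'%:~R * p%:~R - k%:~R * q%:~R : R).
      by rewrite /y' /n /e; ring.
    by rewrite ckR subrr.
  (* Drift and residue each contribute at most [q * |e|], and [|e| * Q < 1]. *)
  apply: le_trans (ler_normD _ _) _.
  have le2 : `|j'%:~R * e| <= q%:~R * `|e|.
    by rewrite normrM ger0_norm // ler_wpM2r // ltW.
  apply: (@le_trans _ _ (2 * (q%:~R * `|e|))); first lra.
  rewrite mulrCA ler_pM2l // ler_pM2l // -[X in _ <= X]mul1r ler_pdivlMr //.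
  exact: ltW.
Qed.

(** Swapping the coordinates and reflecting the first one reduces this to [flow_near_int_aux]. *)
Lemma flow_near_int (R : realType) (A B x y : R) (Q : nat) :
  (0 < Q)%N -> (2 * Q%:R + 2 <= `|A|) || (2 * Q%:R + 2 <= `|B|) ->
  nonresonant R A B Q ->
  exists (r : R) (i j : int),
    [/\ 0 <= r <= 1, `|x + r * A - i%:~R| <= 2 / Q%:R
      & `|y + r * B - j%:~R| <= 2 / Q%:R].
Proof.
move=> Q_gt0; wlog BA : A B x y / `|B| <= `|A|.
  move=> H AB nores; have [BA|/ltW BA] := leP `|B| `|A|; first exact: H.
  have nores' : nonresonant R B A Q.
    move=> m n mn mQ nQ; rewrite addrC; apply: nores => //.
    by move: mn; rewrite !xpair_eqE andbC.
  rewrite orbC in AB; have [r [i [j [r01 h1 h2]]]] := H B A y x BA AB nores'.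
  by exists r, j, i.
wlog A_ge0 : A x BA / 0 <= A.
  move=> H AB nores; have [A_ge0|/ltW A_le0] := leP 0 A; first exact: H.
  have nores' : nonresonant R (- A) B Q.
    move=> m n mn mQ nQ; rewrite mulrN -mulNr -intrN; apply: nores; rewrite ?normrN //.
    by move: mn; rewrite !xpair_eqE oppr_eq0.
  rewrite -oppr_ge0 in A_le0; rewrite -[`|A|]normrN in BA AB.
  have [r [i [j [r01 h1 h2]]]] := H _ (- x) BA A_le0 AB nores'.
  exists r, (- i), j; split => //.
  by rewrite -normrN; move: h1; rewrite intrN; congr (`|_| <= _); ring.
move=> AB; rewrite (ger0_norm A_ge0) in BA AB.
have Q_ge0 : 0 <= Q%:R :> R by [].
by apply: flow_near_int_aux => //; case/orP: AB; lra.
Qed.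

(** * Arithmetic of the cubic field of the cube root of 2, and resonances *)

(* The norm form of Q(2^(1/3)); a zero would allow an infinite 2-adic descent. *)
Lemma cubic_norm_neq0 (a b c : int) :
  (a, b, c) != (0, 0, 0) -> a ^+ 3 + 2 * b ^+ 3 + 4 * c ^+ 3 - 6 * a * b * c != 0.
Proof.
suff H k : forall x y z : int, (`|x| + `|y| + `|z| < k)%N ->
    x ^+ 3 + 2 * y ^+ 3 + 4 * z ^+ 3 - 6 * x * y * z = 0 ->
    [/\ x = 0, y = 0 & z = 0].
  apply: contraNN => /eqP h.
  by have [-> -> ->] := H _ a b c (ltnSn _) h.
elim: k => // k IH x y z szk N0.
have evenX (n m : int) : n ^+ 3 = 2 * m -> exists n', n = 2 * n'.
  move=> nm; have [n' [-> //|nE]] : exists n', n = 2 * n' \/ n = 2 * n' + 1.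
    by exists (n %/ 2)%Z; lia.
  - by exists n'.
  - exfalso; move: nm; rewrite nE.
    have -> : (2 * n' + 1) ^+ 3 = 2 * (4 * n' ^+ 3 + 6 * n' ^+ 2 + 3 * n') + 1 by ring.
    lia.
(* The equation makes [x ^+ 3] even; halving it after each substitution does the same for [y], then
   [z]. *)
have [x' xE] : exists x', x = 2 * x'.
  by apply: (evenX _ (- y ^+ 3 - 2 * z ^+ 3 + 3 * x * y * z)); lra.
have [y' yE] : exists y', y = 2 * y'.
  by apply: (evenX _ (- 2 * x' ^+ 3 - z ^+ 3 + 3 * x' * y * z)); move: N0; rewrite xE; lra.
have [z' zE] : exists z', z = 2 * z'.
  apply: (evenX _ (- 2 * y' ^+ 3 - x' ^+ 3 + 3 * x' * y' * z)).
  by move: N0; rewrite xE yE; lra.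
have [x0|x_neq0] := eqVneq (`|x| + `|y| + `|z|)%N 0%N; first by split; lia.
have [||x0 y0 z0] := IH x' y' z'; [lia| | by split; lia].
by move: N0; rewrite xE yE zE; lra.
Qed.

Lemma exists_cbrt2 (R : realType) : exists2 t : R, 1 <= t <= 2 & t ^+ 3 = 2.
Proof.
have t3 : (2 `^ (3%:R^-1)) ^+ 3 = 2 :> R.
  by rewrite -powR_mulrn ?powR_ge0 // -powRrM mulVf ?pnatr_eq0 // powRr1.
exists (2 `^ (3%:R^-1)) => //; apply/andP; split.
- by rewrite -[X in X <= _](powRr0 2) ler_powR //; lra.
- by apply: ler1_powR; lra.
Qed.

(** The norm is a nonzero integer and equals the form times a cofactor of size at most
    [17 * H ^+ 2]. *)
Lemma cubic_form_lower_bound (R : realType) (t H : R) (a b c : int) :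
  1 <= t <= 2 -> t ^+ 3 = 2 -> (a, b, c) != (0, 0, 0) ->
  `|a%:~R| <= H -> `|b%:~R| <= H -> `|c%:~R| <= H ->
  1 <= 17 * H ^+ 2 * `|a%:~R + b%:~R * t + c%:~R * t ^+ 2|.
Proof.
move=> /andP[t1 t2] t3 abc aH bH cH.
have N1 := intr_norm_ge1 R _ (cubic_norm_neq0 _ _ _ abc).
set x := _ + _ * t ^+ 2.
set A : R := a%:~R in aH x *; set B : R := b%:~R in bH x *; set C : R := c%:~R in cH x *.
(* The product of the two other conjugates of [x], reduced by [t ^+ 3 = 2]. *)
pose w := A * A + B * B * t ^+ 2 + 2 * (C * C) * t - A * B * t - A * C * t ^+ 2 - 2 * (B * C).
have NE : (a ^+ 3 + 2 * b ^+ 3 + 4 * c ^+ 3 - 6 * a * b * c)%:~R = x * w :> R.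
  rewrite !(intrD, intrB, intrN, intrM, rmorphXn) /= -/A -/B -/C.
  have -> : x * w = A ^+ 3 + B ^+ 3 * t ^+ 3 + 2 * C ^+ 3 * t ^+ 3
      + (2 - t ^+ 3) * (2 * (A * B * C) + A * C ^+ 2 * t - B ^+ 2 * C * t)
      - 6 * A * B * C.
    rewrite /x /w; ring.
  rewrite t3; ring.
have H0 : 0 <= H by apply: le_trans aH.
have pr (u v k M : R) : `|u| <= H -> `|v| <= H -> `|k| <= M ->
    `|u * v * k| <= H ^+ 2 * M.
  by move=> uH vH kM; rewrite !normrM expr2; do 2 rewrite ler_pM ?mulr_ge0 //.
have t4 : `|t ^+ 2| <= 4 by rewrite ger0_norm ?sqr_ge0 // expr2; nra.
have wH : `|w| <= 17 * H ^+ 2.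
  (* The six terms contribute 1 + 4 + 4 + 2 + 4 + 2 = 17. *)
  have -> : w = A * A * 1 + B * B * t ^+ 2 + C * C * (2 * t) - A * B * t
                - A * C * t ^+ 2 - B * C * 2 by rewrite /w; ring.
  have := pr A A 1 1 aH aH; have := pr B B _ _ bH bH t4.
  have := pr C C (2 * t) 4 cH cH; have := pr A B t 2 aH bH.
  have := pr A C _ _ aH cH t4; have := pr B C 2 2 bH cH.
  rewrite normr1 ![`|2|]ger0_norm // ![`|t|]ger0_norm; last lra.
  rewrite [`|2 * t|]ger0_norm; last lra.
  move=> /(_ (lexx _)) h1 h2 /(_ t2) h3 /(_ ltac:(lra)) h4 h5 /(_ (lexx _)) h6.
  rewrite !ler_norml in h1 h2 h3 h4 h5 h6 *; lra.
move: N1; rewrite NE normrM => N1; apply: (le_trans N1).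
by rewrite mulrC ler_wpM2r.
Qed.

Lemma nonresonantPn (R : realType) (A B : R) (Q : nat) : ~ nonresonant R A B Q ->
  exists m n : int, [/\ (m, n) != (0, 0), `|m%:~R : R| <= Q%:R,
    `|n%:~R : R| <= Q%:R & `|m%:~R * A + n%:~R * B| < 2].
Proof.
move=> /existsNP[m] /existsNP[n] /not_implyP[mn] /not_implyP[mQ] /not_implyP[nQ].
by move/negP; rewrite -ltNge => h; exists m, n; split;
  rewrite // -intr_norm pmulrn ler_int.
Qed.

(* Two frequencies nearly orthogonal to d have a determinant small compared with
   1/|d|; the cubic norm bounds a nonzero determinant from below. *)
Lemma resonant_pair_bound (R : realType) (t q d1 d2 x1 y1 x2 y2 : R) (a b c : int) :
  1 <= t <= 2 -> t ^+ 3 = 2 -> (a, b, c) != (0, 0, 0) ->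
  `|a%:~R| <= q ^+ 2 -> `|b%:~R| <= q ^+ 2 -> `|c%:~R| <= q ^+ 2 ->
  x1 * y2 - y1 * x2 = a%:~R + b%:~R * t + c%:~R * t ^+ 2 ->
  `|x1| <= 5 * q -> `|y1| <= 5 * q -> `|x2| <= 5 * q -> `|y2| <= 5 * q ->
  `|x1 * d1 + y1 * d2| < 2 -> `|x2 * d1 + y2 * d2| < 2 ->
  `|d1| + `|d2| <= 680 * q ^+ 5.
Proof.
move=> t12 t3 abc aq bq cq detE hx1 hy1 hx2 hy2 E1 E2.
have := cubic_form_lower_bound _ _ _ _ _ _ t12 t3 abc aq bq cq.
rewrite -detE (_ : (q ^+ 2) ^+ 2 = q ^+ 4); last ring.
set D := x1 * y2 - y1 * x2 => D1.
have two (e e' k k' : R) : `|e| < 2 -> `|e'| < 2 -> `|k| <= 5 * q -> `|k'| <= 5 * q ->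
    `|e * k - e' * k'| <= 20 * q.
  move=> he he' hk hk'; apply: le_trans (ler_normB _ _) _; rewrite !normrM.
  have := ler_pM (normr_ge0 e) (normr_ge0 k) (ltW he) hk.
  have := ler_pM (normr_ge0 e') (normr_ge0 k') (ltW he') hk'.
  lra.
(* Cramer's rule for [d1], then for [d2]. *)
have Dd1 : `|D| * `|d1| <= 20 * q.
  rewrite -normrM (_ : D * d1 = (x1 * d1 + y1 * d2) * y2 - (x2 * d1 + y2 * d2) * y1).
    exact: two.
  by rewrite /D; ring.
have Dd2 : `|D| * `|d2| <= 20 * q.
  rewrite -normrM (_ : D * d2 = (x2 * d1 + y2 * d2) * x1 - (x1 * d1 + y1 * d2) * x2).
    exact: two.
  by rewrite /D; ring.
have q4 : 0 <= 17 * q ^+ 4 by rewrite mulr_ge0 // exprn_even_ge0.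
(* 17 * 20 = 340, and the two coordinates add up to 680. *)
have scale (d : R) : `|D| * `|d| <= 20 * q -> `|d| <= 340 * q ^+ 5.
  move=> Dd; have := ler_wpM2r (normr_ge0 d) D1; rewrite mul1r => /le_trans; apply.
  have := ler_wpM2l q4 Dd; rewrite mulrA => /le_trans; apply.
  by rewrite [leLHS](_ : _ = 340 * q ^+ 5) //; ring.
by have := scale _ Dd1; have := scale _ Dd2; lra.
Qed.

Lemma some_pair_nonresonant (R : realType) (t d1 d2 : R) (Q : nat) :
  1 <= t <= 2 -> t ^+ 3 = 2 -> 680 * Q%:R ^+ 5 < `|d1| + `|d2| ->
  let w := t * d1 + t ^+ 2 * d2 in
  [\/ nonresonant R d1 d2 Q, nonresonant R d2 w Q | nonresonant R w d1 Q].
Proof.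
move=> t12 t3 big w.
have [|/nonresonantPn[m1 [n1 [k1 m1Q n1Q E1]]]] := pselect (nonresonant R d1 d2 Q).
  by constructor 1.
have [|/nonresonantPn[m2 [n2 [k2 m2Q n2Q E2]]]] := pselect (nonresonant R d2 w Q).
  by constructor 2.
have [|/nonresonantPn[m3 [n3 [k3 m3Q n3Q E3]]]] := pselect (nonresonant R w d1 Q).
  by constructor 3.
exfalso.
have /andP[t1 t2] := t12.
have Q0 : 0 <= Q%:R :> R by [].
have tt4 : `|t ^+ 2| <= 4 by rewrite ger0_norm ?sqr_ge0 // expr2; nra.
have tt2 : `|t| <= 2 by rewrite ger0_norm; lra.
have prod (m n : int) : `|m%:~R : R| <= Q%:R -> `|n%:~R : R| <= Q%:R ->
    `|(m * n)%:~R : R| <= Q%:R ^+ 2.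
  by move=> mQ nQ; rewrite intrM normrM expr2 ler_pM.
have prodN (m n : int) : `|m%:~R : R| <= Q%:R -> `|n%:~R : R| <= Q%:R ->
    `|(- (m * n))%:~R : R| <= Q%:R ^+ 2.
  by move=> mQ nQ; rewrite intrN normrN prod.
have bt (m : int) : `|m%:~R : R| <= Q%:R -> `|m%:~R * t| <= Q%:R * 2.
  by move=> mQ; rewrite normrM ler_pM.
have btt (m : int) : `|m%:~R : R| <= Q%:R -> `|m%:~R * t ^+ 2| <= Q%:R * 4.
  by move=> mQ; rewrite normrM ler_pM.
have Q5 (x : R) : `|x| <= Q%:R -> `|x| <= 5 * Q%:R by lra.
have x2b : `|n2%:~R * t| <= 5 * Q%:R by have := bt _ n2Q; lra.
have y2b : `|m2%:~R + n2%:~R * t ^+ 2| <= 5 * Q%:R.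
  by apply: le_trans (ler_normD _ _) _; have := btt _ n2Q; lra.
have E2' : `|n2%:~R * t * d1 + (m2%:~R + n2%:~R * t ^+ 2) * d2| < 2.
  by move: E2; rewrite /w; congr (`|_| < _); ring.
(* The coordinates in [1], [t], [t ^+ 2] of the determinant of the first two frequencies. *)
have /eqP[/eqP m1m2 /eqP n1n2 /eqP m1n2] : (m1 * m2, - (n1 * n2), m1 * n2) == (0, 0, 0).
  apply/negPn/negP => abc.
  have := @resonant_pair_bound R t Q%:R d1 d2 m1%:~R n1%:~R (n2%:~R * t)
    (m2%:~R + n2%:~R * t ^+ 2) _ _ _ t12 t3 abc.
  move=> /(_ (prod _ _ m1Q m2Q) (prodN _ _ n1Q n2Q) (prod _ _ m1Q n2Q)) H.
  suff : `|d1| + `|d2| <= 680 * Q%:R ^+ 5 by rewrite leNgt big.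
  apply: H => //; rewrite ?Q5 // intrN !intrM; ring.
(* Likewise for the last two frequencies, where the [t ^+ 3] terms cancel. *)
have /eqP[/eqP m2n3 /eqP m2m3 /eqP n2n3] :
    (- (m2 * n3), - (m2 * m3), - (n2 * n3)) == (0, 0, 0).
  apply/negPn/negP => abc.
  have := @resonant_pair_bound R t Q%:R d1 d2 (n2%:~R * t)
    (m2%:~R + n2%:~R * t ^+ 2) (m3%:~R * t + n3%:~R) (m3%:~R * t ^+ 2) _ _ _ t12 t3 abc.
  move=> /(_ (prodN _ _ m2Q n3Q) (prodN _ _ m2Q m3Q) (prodN _ _ n2Q n3Q)) H.
  suff : `|d1| + `|d2| <= 680 * Q%:R ^+ 5 by rewrite leNgt big.
  apply: H => //.
  - by rewrite !intrN !intrM; ring.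
  - by apply: le_trans (ler_normD _ _) _; have := bt _ m3Q; lra.
  - by have := btt _ m3Q; lra.
  - by move: E3; rewrite /w; congr (`|_| < _); ring.
(* A nonzero [m2] would give [m3 = n3 = 0]; so [m2 = 0], [n2] is nonzero, and [m1 = n1 = 0], a
   contradiction. *)
move: k1 k2 k3 m1m2 n1n2 m1n2 m2n3 m2m3 n2n3.
rewrite !xpair_eqE !oppr_eq0 !mulf_eq0.
by do 6 case: eqP => _ //=.
Qed.

(** * Coordinates in dimension two *)

Lemma sum_ord2 (R : realType) (F : 'I_2 -> R) : \sum_(i < 2) F i = F 0 + F 1.
Proof. by rewrite !big_ord_recl big_ord0 addr0; congr (_ + F _); apply/val_inj. Qed.

Lemma rV2_eq (T : Type) (x y : 'rV[T]_2) : x 0 0 = y 0 0 -> x 0 1 = y 0 1 -> x = y.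
Proof.
move=> h0 h1; apply/rowP => -[[|[|//]] i].
- by rewrite (_ : Ordinal i = 0) //; apply/val_inj.
- by rewrite (_ : Ordinal i = 1) //; apply/val_inj.
Qed.

Definition mx2 (R : realType) (a b c d : R) : 'M[R]_2 :=
  \matrix_(i, j) (if i == 0 then if j == 0 then a else b
                  else if j == 0 then c else d).

Lemma mx2M (R : realType) (a b c d a' b' c' d' : R) :
  mx2 R a b c d *m mx2 R a' b' c' d' =
  mx2 R (a * a' + b * c') (a * b' + b * d') (c * a' + d * c') (c * b' + d * d').
Proof.
by apply/matrixP => i j; rewrite !mxE sum_ord2 !mxE; do 2 case: ifP.
Qed.

Lemma mx2_1 (R : realType) : mx2 R 1 0 0 1 = 1%:M.
Proof.
apply/matrixP => -[[|[|//]] hi] [[|[|//]] hj]; by rewrite !mxE.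
Qed.

(** * Grids cut out by two linear forms *)

Section EuclideanPlane.
Context {R : realType}.
Implicit Types (x y : 'rV[R]_2).

Lemma euclid_dist_le x y : euclid_dist x y <= `|x 0 0 - y 0 0| + `|x 0 1 - y 0 1|.
Proof.
rewrite /euclid_dist sum_ord2 -(real_normK (num_real (x 0 0 - y 0 0))).
rewrite -(real_normK (num_real (x 0 1 - y 0 1))).
set a := `|x 0 0 - _|; set b := `|x 0 1 - _|.
have a0 : 0 <= a := normr_ge0 _; have b0 : 0 <= b := normr_ge0 _.
rewrite -[leRHS]ger0_norm ?addr_ge0 // -sqrtr_sqr ler_wsqrtr //.
by have := mulr_ge0 a0 b0; rewrite sqrrD; lra.
Qed.

Lemma coord_le_euclid_dist x y :
  `|x 0 0 - y 0 0| <= euclid_dist x y /\ `|x 0 1 - y 0 1| <= euclid_dist x y.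
Proof.
by rewrite /euclid_dist sum_ord2 -!sqrtr_sqr; split; apply: ler_wsqrtr;
   rewrite ?lerDl ?lerDr sqr_ge0.
Qed.

Definition linform (h : R * R) x : R := h.1 * x 0 0 + h.2 * x 0 1.

Definition grid (f g : R * R) (s1 s2 : R) : set 'rV[R]_2 :=
  [set x | exists i j : int, linform f x = i%:~R + s1 /\ linform g x = j%:~R + s2].

(** Quantitative independence of the forms; 6 is what the estimate in [coercive_vw] gives, and it
    serves all three pairs. *)
Definition coercive_pair (f g : R * R) : Prop :=
  forall x (e : R), `|linform f x| <= e -> `|linform g x| <= e ->
    `|x 0 0| + `|x 0 1| <= 6 * e.

(** The lattice basis is dual to the forms: [B] inverts the matrix [M] with columns [f] and [g], and
    [x *m M] lists the values of the forms at [x]. *)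
Lemma grid_translated_lattice (f g : R * R) (s1 s2 : R) :
  f.1 * g.2 - f.2 * g.1 != 0 -> is_translated_lattice (grid f g s1 s2).
Proof.
set D := _ - _ => D0.
pose B := mx2 R (g.2 / D) (- g.1 / D) (- f.2 / D) (f.1 / D).
pose M := mx2 R f.1 g.1 f.2 g.2.
have BM : B *m M = 1%:M.
  by rewrite /B /M mx2M -mx2_1; congr (mx2 R _ _ _ _); rewrite /D; field.
have [uB _] := mulmx1_unit BM.
have MB : M *m B = 1%:M by exact: mulmx1C.
pose s : 'rV[R]_2 := \row_j (if j == 0 then s1 else s2).
have linM x : linform f x = (x *m M) 0 0 /\ linform g x = (x *m M) 0 1.
  by rewrite !mxE !sum_ord2 !mxE /linform /=; split; ring.
exists (s *m B), [set map_mx intr z *m B | z in [set: 'rV[int]_2]]; split.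
  by exists B.
apply/seteqP; split => x.
- move=> [i [j [xi xj]]].
  pose z : 'rV[int]_2 := \row_k (if k == 0 then i else j).
  exists (map_mx intr z *m B); first by exists z.
  rewrite -mulmxDl -[RHS]mulmx1 -MB mulmxA; congr (_ *m _).
  by have [h1 h2] := linM x; apply: rV2_eq; rewrite -?h1 -?h2 ?xi ?xj !mxE /= addrC.
- move=> [l [z _ <-] <-]; exists (z 0 0), (z 0 1).
  have [-> ->] := linM (s *m B + map_mx intr z *m B).
  by rewrite -mulmxDl -mulmxA BM mulmx1 !mxE /= ![_ + s1]addrC ![_ + s2]addrC.
Qed.

(** The forms turn the segment into a line on the torus, where [flow_near_int] applies; coercivity
    converts its error [2 / Q] into a distance, whence 12 = 6 * 2. *)
Lemma grid_near (f g : R * R) (s1 s2 : R) (Q : nat) (a b : 'rV[R]_2) :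
  f.1 * g.2 - f.2 * g.1 != 0 ->
  coercive_pair f g ->
  (0 < Q)%N -> 680 * Q%:R ^+ 5 < `|(b - a) 0 0| + `|(b - a) 0 1| ->
  nonresonant R (linform f (b - a)) (linform g (b - a)) Q ->
  comes_within (12 / Q%:R) (line_segment a b) (grid f g s1 s2).
Proof.
move=> D0 bound Q0 big nores.
have Q1 : 1 <= Q%:R :> R by rewrite ler1n.
(* Otherwise coercivity bounds the length by [6 * (2 * Q + 2) <= 24 * Q], against [big]. *)
have large : (2 * Q%:R + 2 <= `|linform f (b - a)|) ||
             (2 * Q%:R + 2 <= `|linform g (b - a)|).
  apply/negPn/negP; rewrite negb_or -!ltNge => /andP[/ltW h1 /ltW h2].
  have := bound _ _ h1 h2; apply/negP; rewrite -ltNge; apply: le_lt_trans big.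
  have : Q%:R <= Q%:R ^+ 5 :> R by rewrite -[leLHS]expr1 ler_weXn2l.
  lra.
have [r [i [j [/andP[r0 r1] hi hj]]]] := flow_near_int _ _ _
  (linform f a - s1) (linform g a - s2) _ Q0 large nores.
set D := _ - _ in D0.
(* The grid point with levels [i + s1] and [j + s2], by Cramer's rule. *)
pose z : 'rV[R]_2 := \row_k
  (if k == 0 then (g.2 * (i%:~R + s1) - f.2 * (j%:~R + s2)) / D
   else (f.1 * (j%:~R + s2) - g.1 * (i%:~R + s1)) / D).
have zf : linform f z = i%:~R + s1 by rewrite /linform !mxE /= /D; field.
have zg : linform g z = j%:~R + s2 by rewrite /linform !mxE /= /D; field.
pose p := (1 - r) *: a + r *: b.
exists p, z; split.
- by exists r => //=; rewrite in_itv /= r0 r1.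
- by exists i, j.
- apply: le_trans (euclid_dist_le _ _) _.
  have := bound (p - z) (2 / Q%:R); rewrite !mxE => H.
  rewrite (_ : 12 / Q%:R = 6 * (2 / Q%:R)); last by field; rewrite pnatr_eq0 -lt0n.
  apply: H.
  + rewrite (_ : linform f (p - z) =
        linform f a - s1 + r * linform f (b - a) - i%:~R) //.
    have -> : i%:~R = linform f z - s1 by rewrite zf addrK.
    by rewrite /linform /p !mxE; ring.
  + rewrite (_ : linform g (p - z) =
        linform g a - s2 + r * linform g (b - a) - j%:~R) //.
    have -> : j%:~R = linform g z - s2 by rewrite zg addrK.
    by rewrite /linform /p !mxE; ring.
Qed.

Lemma linform_dist (h : R * R) x y : `|h.1| <= 4 -> `|h.2| <= 4 ->
  `|linform h x - linform h y| <= 8 * euclid_dist x y.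
Proof.
move=> h1 h2; have [d1 d2] := coord_le_euclid_dist x y.
have -> : linform h x - linform h y = h.1 * (x 0 0 - y 0 0) + h.2 * (x 0 1 - y 0 1).
  by rewrite /linform; ring.
apply: le_trans (ler_normD _ _) _; rewrite !normrM.
have := ler_pM (normr_ge0 _) (normr_ge0 _) h1 d1.
have := ler_pM (normr_ge0 _) (normr_ge0 _) h2 d2.
lra.
Qed.

Lemma half_int_norm (n : int) (s : R) : `|s| = 1 / 2 -> 1 / 2 <= `|n%:~R + s|.
Proof.
move=> sE; have [->|n0] := eqVneq n 0; first by rewrite add0r sE.
have := intr_norm_ge1 R n n0; have := ler_normB (n%:~R + s) s; rewrite addrK; lra.
Qed.

(** The values of [h] differ by an odd multiple of 1/2, and [h] is 8-Lipschitz. *)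
Lemma shifted_levels_apart (h : R * R) (s s' : R) (i j : int) x y :
  `|h.1| <= 4 -> `|h.2| <= 4 -> `|s - s'| = 1 / 2 ->
  linform h x = i%:~R + s -> linform h y = j%:~R + s' -> 1 / 16 <= euclid_dist x y.
Proof.
move=> h1 h2 ss' xi yj; have := linform_dist h x y h1 h2.
have := half_int_norm (i - j) (s - s') ss'.
have -> : (i - j)%:~R + (s - s') = linform h x - linform h y.
  by rewrite xi yj intrB; ring.
lra.
Qed.

(** Some form takes values differing by a nonzero integer, since coercivity with [e = 0] would
    otherwise identify the points. *)
Lemma grid_uniformly_discrete (f g : R * R) (s1 s2 : R) x y :
  coercive_pair f g -> `|f.1| <= 4 -> `|f.2| <= 4 -> `|g.1| <= 4 -> `|g.2| <= 4 ->
  grid f g s1 s2 x -> grid f g s1 s2 y -> x <> y -> 1 / 16 <= euclid_dist x y.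
Proof.
move=> bound f1 f2 g1 g2 [i [j [xi xj]]] [i' [j' [yi yj]]] xy.
have dE (m n : int) (s : R) : m%:~R + s - (n%:~R + s) = (m - n)%:~R.
  by rewrite intrB; ring.
have := linform_dist f x y f1 f2; have := linform_dist g x y g1 g2.
rewrite xi xj yi yj !dE.
have [ii|ii] := eqVneq (i - i') 0; last by have := intr_norm_ge1 R _ ii; lra.
have [jj|jj] := eqVneq (j - j') 0; last by have := intr_norm_ge1 R _ jj; lra.
move=> _ _; exfalso; apply: xy.
have lin h : linform h (x - y) = linform h x - linform h y.
  by rewrite /linform !mxE; ring.
have := bound (x - y) 0; rewrite !lin xi xj yi yj !dE ii jj.
rewrite normr0 lexx mulr0 !mxE => /(_ isT isT) xy0.
have := normr_ge0 (x 0 0 - y 0 0); have := normr_ge0 (x 0 1 - y 0 1) => p1 p0.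
by apply: rV2_eq; apply/eqP; rewrite -subr_eq0 -normr_le0; lra.
Qed.

End EuclideanPlane.

(** * The three grids: separation and visibility *)

Section ThreeGrids.
Context {R : realType} (t : R) (t12 : 1 <= t <= 2) (t3 : t ^+ 3 = 2).

Let u : R * R := (1, 0).
Let v : R * R := (0, 1).
Let w : R * R := (t, t ^+ 2).

Let tt14 : 1 <= t ^+ 2 <= 4.
Proof. by case/andP: t12 => t1 t2; rewrite expr2; apply/andP; split; nra. Qed.

Lemma coercive_uv : coercive_pair u v.
Proof.
move=> x e; rewrite /linform /= !mul1r !mul0r addr0 add0r => h0 h1.
by have := normr_ge0 (x 0 0); lra.
Qed.

Lemma coercive_vw : coercive_pair v w.
Proof.
move=> x e; rewrite /linform /= mul0r add0r mul1r => h1 hw.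
have /andP[t1 t2] := t12; have /andP[tt1 tt4] := tt14.
(* Solving [w] for the first coordinate gives [|x 0 0| <= 5 * e]. *)
have := ler_normB (t * x 0 0 + t ^+ 2 * x 0 1) (t ^+ 2 * x 0 1).
rewrite addrK !normrM [`|t|]ger0_norm ?[`|t ^+ 2|]ger0_norm ?sqr_ge0; [|lra..].
have := ler_wpM2r (normr_ge0 (x 0 0)) t1; have := ler_wpM2r (normr_ge0 (x 0 1)) tt4.
lra.
Qed.

Lemma coercive_wu : coercive_pair w u.
Proof.
move=> x e; rewrite /linform /= mul0r addr0 mul1r => hw h0.
have /andP[t1 t2] := t12; have /andP[tt1 tt4] := tt14.
have := ler_normB (t * x 0 0 + t ^+ 2 * x 0 1) (t * x 0 0).
rewrite [_ - t * _]addrC addKr !normrM.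
rewrite [`|t|]ger0_norm ?[`|t ^+ 2|]ger0_norm ?sqr_ge0; [|lra..].
have := ler_wpM2r (normr_ge0 (x 0 0)) t2; have := ler_wpM2r (normr_ge0 (x 0 1)) tt1.
by have := normr_ge0 (x 0 0); lra.
Qed.

(* Any two of the grids share a linear form, on which their shifts differ by 1/2. *)
Definition three_grids : set 'rV[R]_2 :=
  grid u v 0 0 `|` grid v w (1 / 2) 0 `|` grid w u (1 / 2) (1 / 2).

Let det_uv : u.1 * v.2 - u.2 * v.1 != 0.
Proof. by rewrite /= mul1r mul0r subr0 oner_eq0. Qed.

Let det_vw : v.1 * w.2 - v.2 * w.1 != 0.
Proof. by case/andP: t12 => t1 _; rewrite lt_eqF //=; lra. Qed.

Let det_wu : w.1 * u.2 - w.2 * u.1 != 0.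
Proof. by case/andP: tt14 => t1 _; rewrite lt_eqF //=; lra. Qed.

Lemma three_grids_lattices : exists S1 S2 S3 : set 'rV[R]_2,
  [/\ is_translated_lattice S1, is_translated_lattice S2,
      is_translated_lattice S3 & three_grids = S1 `|` S2 `|` S3].
Proof.
exists (grid u v 0 0), (grid v w (1 / 2) 0), (grid w u (1 / 2) (1 / 2)).
by split => //; apply: grid_translated_lattice.
Qed.

Lemma three_grids_uniformly_discrete : uniformly_discrete three_grids.
Proof.
exists (1 / 16); first lra.
have [n0 n1] : `|0 : R| <= 4 /\ `|1 : R| <= 4 by rewrite normr0 normr1; split; lra.
have /andP[t1 t2] := t12; have /andP[tt1 tt4] := tt14.
have nt : `|t| <= 4 by rewrite ger0_norm; lra.
have ntt : `|t ^+ 2| <= 4 by rewrite ger0_norm; lra.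
have half1 : `|1 / 2 - 0 : R| = 1 / 2 by rewrite ger0_norm; lra.
have half2 : `|0 - 1 / 2 : R| = 1 / 2 by rewrite ler0_norm; lra.
(* Points of different grids are separated by the shared form: [v] for the first two grids, [u] for
   the first and third, [w] for the last two. *)
move=> x y [[Gx|Gx]|Gx] [[Gy|Gy]|Gy] xy.
- exact: (grid_uniformly_discrete u v 0 0 _ _ coercive_uv).
- by move: Gx Gy => [i [j [_ xj]]] [i' [j' [yi _]]]; apply: shifted_levels_apart xj yi.
- by move: Gx Gy => [i [j [xi _]]] [i' [j' [_ yj]]]; apply: shifted_levels_apart xi yj.
- by move: Gx Gy => [i [j [xi _]]] [i' [j' [_ yj]]]; apply: shifted_levels_apart xi yj.
- exact: (grid_uniformly_discrete v w (1 / 2) 0 _ _ coercive_vw).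
- by move: Gx Gy => [i [j [_ xj]]] [i' [j' [yi _]]]; apply: shifted_levels_apart xj yi.
- by move: Gx Gy => [i [j [_ xj]]] [i' [j' [yi _]]]; apply: shifted_levels_apart xj yi.
- by move: Gx Gy => [i [j [xi _]]] [i' [j' [_ yj]]]; apply: shifted_levels_apart xi yj.
- exact: (grid_uniformly_discrete w u (1 / 2) (1 / 2) _ _ coercive_wu).
Qed.

Lemma three_grids_visibility (e : R) (a b : 'rV[R]_2) : 0 < e -> e < 1 ->
  680 * (13 / e) ^+ 5 < euclid_dist a b ->
  comes_within e (line_segment a b) three_grids.
Proof.
move=> e0 e1 len.
have x0 : 0 < 12 / e by rewrite divr_gt0.
(* Rounding [12 / e] up gives [12 / Q <= e], and [Q <= 13 / e] because [e < 1]. *)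
have /andP[] := ceil_itv (12 / e); have : 0 < Num.ceil (12 / e) by rewrite ceil_gt0.
case: (Num.ceil _) => // Q Q0; rewrite intrB -pmulrn => Q1 Q2.
have {}Q0 : (0 < Q)%N by [].
have Qe : Q%:R <= 13 / e.
  have : 1 <= 1 / e by rewrite ler_pdivlMr // mul1r ltW.
  by move: Q1; rewrite /=; lra.
have big : 680 * Q%:R ^+ 5 < `|(b - a) 0 0| + `|(b - a) 0 1|.
  apply: le_lt_trans (_ : 680 * (13 / e) ^+ 5 < _).
    rewrite ler_pM2l ?ltr0n //; apply: lerXn2r Qe; rewrite nnegrE ?ler0n //.
    by rewrite divr_ge0 ?ler0n // ltW.
  apply: lt_le_trans len _; rewrite !mxE.
  by rewrite ![`|b _ _ - _|]distrC euclid_dist_le.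
suff [x [y [ax Yy xy]]] : comes_within (12 / Q%:R) (line_segment a b) three_grids.
  exists x, y; split => //; apply: le_trans xy _.
  by rewrite ler_pdivrMr ?ltr0n // mulrC -ler_pdivrMr.
have uE : linform u (b - a) = (b - a) 0 0 by rewrite /linform /= mul1r mul0r addr0.
have vE : linform v (b - a) = (b - a) 0 1 by rewrite /linform /= mul1r mul0r add0r.
have := some_pair_nonresonant R t _ _ Q t12 t3 big; rewrite /= -uE -vE => -[] nores.
- have [|x [y [ax Yy xy]]] :=
    grid_near u v 0 0 Q a b det_uv coercive_uv Q0 big; first by rewrite uE vE in nores *.
  by exists x, y; split => //; left; left.
- have [|x [y [ax Yy xy]]] :=
    grid_near v w (1 / 2) 0 Q a b det_vw coercive_vw Q0 big.
    by rewrite uE vE in nores *.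
  by exists x, y; split => //; left; right.
- have [|x [y [ax Yy xy]]] :=
    grid_near w u (1 / 2) (1 / 2) Q a b det_wu coercive_wu Q0 big.
    by rewrite uE vE in nores *.
  by exists x, y; split => //; right.
Qed.

(** As [e < 1], the power dominates [e ^- 5], so one constant serves every [eta]; 14 in place of 13
    makes the inequality strict. *)
Lemma three_grids_visibility_powR (eta e : R) (a b : 'rV[R]_2) :
  0 < eta -> 0 < e -> e < 1 ->
  euclid_dist a b = (680 * 14 ^+ 5) * e `^ (- (5 + eta)) ->
  comes_within e (line_segment a b) three_grids.
Proof.
move=> eta0 e0 e1 len; apply: three_grids_visibility => //; rewrite len.
have e5 : e ^- 5 <= e `^ (- (5 + eta)).
  rewrite -powR_mulrn ?(ltW e0) // -powRN; apply: ger_powR; last lra.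
  by rewrite e0 ltW.
apply: lt_le_trans (_ : 680 * 14 ^+ 5 * e ^- 5 <= _); last first.
  by apply: ler_wpM2l e5; rewrite mulr_ge0 ?exprn_ge0 ?ler0n.
rewrite exprMn exprVn mulrA ltr_pM2r; last by rewrite invr_gt0 exprn_gt0.
by rewrite ltr_pM2l ?ltr0n // ltrXn2r ?ler0n // ltr_nat.
Qed.

Lemma three_grids_dense_forest : dense_forest three_grids.
Proof.
pose C : R := 680 * 14 ^+ 5.
have C0 : 0 < C by rewrite mulr_gt0 ?exprn_gt0 ?ltr0n.
have half0 : 0 < 1 / 2 :> R by lra.
(* The minimum keeps the argument below 1, where the bound is available; [eta = 1] is an arbitrary
   choice. *)
pose v0 (e : R) := C * (Num.min e (1 / 2)) `^ (- (5 + 1)).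
exists v0 => e e0; have m0 : 0 < Num.min e (1 / 2) by rewrite lt_min e0 half0.
split; first by rewrite mulr_gt0 // powR_gt0.
move=> a b len.
have [|x [y [ax Yy xy]]] :=
  three_grids_visibility_powR _ _ _ _ (@ltr01 R) m0 _ len.
  by rewrite gt_min; apply/orP; right; lra.
by exists x, y; split => //; apply: le_trans xy _; rewrite ge_min lexx.
Qed.

End ThreeGrids.

Theorem theorem1p3 (R : realType) :
  exists Y : set 'rV[R]_2,
    [/\ exists S1 S2 S3 : set 'rV[R]_2,
          [/\ is_translated_lattice S1, is_translated_lattice S2,
              is_translated_lattice S3 & Y = S1 `|` S2 `|` S3],
        uniformly_discrete Y,
        dense_forest Y
      & forall eta : R, 0 < eta ->
          exists2 C : R, 0 < C &
            forall eps : R, 0 < eps -> eps < 1 ->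
              forall a b : 'rV[R]_2,
                euclid_dist a b = C * eps `^ (- (5 + eta)) ->
                comes_within eps (line_segment a b) Y].

Proof.
have [t t12 t3] := exists_cbrt2 R; exists (three_grids t); split.
- exact: three_grids_lattices.
- exact: three_grids_uniformly_discrete.
- exact: three_grids_dense_forest.
- move=> eta eta0; exists (680 * 14 ^+ 5); first by rewrite mulr_gt0 ?exprn_gt0 ?ltr0n.
  by move=> e e0 e1 a b; exact: three_grids_visibility_powR.
Qed.
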